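(* Let $k$ be a field and let $\mathcal{A}$ be an abelian Hom-finite Krull-Schmidt $k$-category with finitely many isomorphism classes of indecomposable objects. Then $\mathcal{A}$ has enough projectives.
   Context: Enough projectives means that for every object $X$ of $\mathcal{A}$ there is an epimorphism from a projective object onto $X$. *)

(* Defs.v *)
From HB Require Import structures.
From mathcomp Require Import all_boot all_order all_algebra.

Set Implicit Arguments.
Unset Strict Implicit.
Unset Printing Implicit Defensive.

Import GRing.Theory.
Local Open Scope ring_scope.

(* A category enriched over k-modules; [comp g f] is "g after f". *)
Record kcategory (k : fieldType) := KCategory {
  obj : Type;
  hom : obj -> obj -> lmodType k;
  idm : forall X, hom X X;
  comp : forall X Y Z, hom Y Z -> hom X Y -> hom X Z;
  comp_idl : forall X Y (f : hom X Y), comp (idm Y) f = f;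
  comp_idr : forall X Y (f : hom X Y), comp f (idm X) = f;
  comp_assoc : forall W X Y Z (h : hom Y Z) (g : hom X Y) (f : hom W X),
    comp h (comp g f) = comp (comp h g) f;
  comp_linear_r : forall X Y Z (g : hom Y Z), linear (@comp X Y Z g);
  comp_linear_l : forall X Y Z (f : hom X Y),
    linear (fun g : hom Y Z => comp g f)
}.

Arguments hom {k} A X Y : rename.
Arguments idm {k A} X : rename.
Arguments comp {k A X Y Z} g f : rename.

Declare Scope kcat_scope.
Notation "g \oc f" := (comp g f) (at level 40, left associativity) : kcat_scope.
Local Open Scope kcat_scope.

Section Notions.

Context {k : fieldType} {A : kcategory k}.
Implicit Types X Y Z W S P : obj A.

Definition is_mono X Y (f : hom A X Y) : Prop :=
  forall W (g h : hom A W X), f \oc g = f \oc h -> g = h.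

Definition is_epi X Y (f : hom A X Y) : Prop :=
  forall Z (g h : hom A Y Z), g \oc f = h \oc f -> g = h.

Definition is_iso X Y (f : hom A X Y) : Prop :=
  exists g : hom A Y X, g \oc f = idm X /\ f \oc g = idm Y.

Definition isomorphic X Y : Prop := exists f : hom A X Y, is_iso f.

(* Initial and terminal; the hom-modules are never empty, so only uniqueness
   has to be required. *)
Definition is_zero X : Prop :=
  (forall Y (f g : hom A X Y), f = g) /\ (forall Y (f g : hom A Y X), f = g).

Definition is_biproduct Y Z S : Prop :=
  exists (i1 : hom A Y S) (i2 : hom A Z S) (p1 : hom A S Y) (p2 : hom A S Z),
    [/\ p1 \oc i1 = idm Y, p2 \oc i2 = idm Z,
        p1 \oc i2 = 0, p2 \oc i1 = 0
      & i1 \oc p1 + i2 \oc p2 = idm S].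

(* For n = 0 the last equation reads 0 = idm S: S is a zero object. *)
Definition is_direct_sum n (X : 'I_n -> obj A) S : Prop :=
  exists (inj : forall i, hom A (X i) S) (prj : forall i, hom A S (X i)),
    [/\ forall i, prj i \oc inj i = idm (X i),
        forall i j, i != j -> prj j \oc inj i = 0
      & \sum_(i < n) inj i \oc prj i = idm S].

Definition is_kernel X Y K (f : hom A X Y) (i : hom A K X) : Prop :=
  f \oc i = 0 /\
  forall W (g : hom A W X), f \oc g = 0 -> exists! h : hom A W K, i \oc h = g.

Definition is_cokernel X Y C (f : hom A X Y) (p : hom A Y C) : Prop :=
  p \oc f = 0 /\
  forall W (g : hom A Y W), g \oc f = 0 -> exists! h : hom A C W, h \oc p = g.

Definition indecomposable X : Prop :=
  ~ is_zero X /\ forall Y Z, is_biproduct Y Z X -> is_zero Y \/ is_zero Z.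

(* A ring is local when it is nonzero and a sum of two non-units is a
   non-unit; the units of the endomorphism ring of X are the isomorphisms. *)
Definition local_endo X : Prop :=
  idm X <> 0 /\
  forall f g : hom A X X, ~ is_iso f -> ~ is_iso g -> ~ is_iso (f + g).

Definition is_projective P : Prop :=
  forall Y Z (e : hom A Y Z), is_epi e ->
  forall f : hom A P Z, exists g : hom A P Y, e \oc g = f.

End Notions.

Section Properties.

Context {k : fieldType} (A : kcategory k).

Definition additive_cat : Prop :=
  (exists X : obj A, is_zero X) /\
  (forall Y Z : obj A, exists S, is_biproduct Y Z S).

Definition abelian_cat : Prop :=
  [/\ additive_cat,
      forall (X Y : obj A) (f : hom A X Y),
        exists K (i : hom A K X), is_kernel f i,
      forall (X Y : obj A) (f : hom A X Y),
        exists C (p : hom A Y C), is_cokernel f p,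
      forall (X Y : obj A) (f : hom A X Y), is_mono f ->
        exists Z (g : hom A Y Z), is_kernel g f
    & forall (X Y : obj A) (f : hom A X Y), is_epi f ->
        exists W (g : hom A W X), is_cokernel g f].

Definition hom_finite : Prop :=
  forall X Y : obj A, exists n : nat, inhabited (Vector.axiom n (hom A X Y)).

Definition krull_schmidt : Prop :=
  additive_cat /\
  forall S : obj A, exists n (X : 'I_n -> obj A),
    (forall i, local_endo (X i)) /\ is_direct_sum X S.

Definition finitely_many_indecomposables : Prop :=
  exists n (X : 'I_n -> obj A),
    forall Y : obj A, indecomposable Y -> exists i, isomorphic Y (X i).

Definition enough_projectives : Prop :=
  forall X : obj A, exists P (p : hom A P X), is_projective P /\ is_epi p.

End Properties.

(* Main.v *)
From HB Require Import structures.
From mathcomp Require Import all_boot all_order all_algebra.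
From mathcomp Require Import boolp.
Require Import Defs.

Set Implicit Arguments.
Unset Strict Implicit.
Unset Printing Implicit Defensive.

Import GRing.Theory.
Local Open Scope ring_scope.
Local Open Scope kcat_scope.

(** Epimorphisms onto a fixed object [X] are compared by the subspaces of the
    hom-spaces [hom (T i) X] formed by the maps that factor through them, where
    [T] lists the indecomposables.  By Krull-Schmidt these finitely many
    finite-dimensional subspaces determine the factorization preorder on maps
    into [X] ([factors_imsize]).  In an abelian category the pullback of two
    epimorphisms is an epimorphism, so an epimorphism [p : P -> X] whose
    subspaces have minimal total dimension lies below all the others: it
    factors through every epimorphism onto [X] ([least_epi_exists]).

    Such a [p] need not have a projective source, since any summand may be
    added to [P].  But among the least epimorphisms onto [X] take one for which
    the total dimension of the spaces [hom (T i) P] is minimal.  If [f] is an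
    endomorphism of [P] with [p f = p], then the restriction of [p] to a
    subobject containing the image of [f] is again least, so this subobject is
    all of [P]; hence [f] is epi and, as [hom P P] is finite-dimensional,
    invertible ([minimal_least_epi_endo]).  Now let [e : Y -> P] be epi.  Since [p] factors through [p e], there is [s] with [p e s = p], so
    [e s] is invertible and [e] splits.  An object onto which every epimorphism
    splits is projective, again by pullback. *)

(** * Preadditive and abelian preliminaries *)

Section Preadditive.

Context {k : fieldType} {A : kcategory k}.
Implicit Types X Y Z W P : obj A.

HB.instance Definition _ X Y Z (g : hom A Y Z) :=
  GRing.isLinear.Build k (hom A X Y) (hom A X Z) _ (@comp k A X Y Z g)
    (@comp_linear_r k A X Y Z g).

Definition precomp X Y Z (f : hom A X Y) (g : hom A Y Z) : hom A X Z := g \oc f.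

HB.instance Definition _ X Y Z (f : hom A X Y) :=
  GRing.isLinear.Build k (hom A Y Z) (hom A X Z) _ (@precomp X Y Z f)
    (@comp_linear_l k A X Y Z f).

Lemma compr0 X Y Z (g : hom A Y Z) : g \oc (0 : hom A X Y) = 0.
Proof. exact: raddf0. Qed.

Lemma comp0r X Y Z (f : hom A X Y) : (0 : hom A Y Z) \oc f = 0.
Proof. exact: (raddf0 (precomp (Z := Z) f)). Qed.

Lemma compDl X Y Z (f : hom A X Y) (g h : hom A Y Z) :
  (g + h) \oc f = g \oc f + h \oc f.
Proof. exact: (raddfD (precomp (Z := Z) f)). Qed.

Lemma compBl X Y Z (f : hom A X Y) (g h : hom A Y Z) :
  (g - h) \oc f = g \oc f - h \oc f.
Proof. exact: (raddfB (precomp (Z := Z) f)). Qed.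

Lemma is_epi0P X Y (f : hom A X Y) :
  is_epi f <-> forall Z (g : hom A Y Z), g \oc f = 0 -> g = 0.
Proof.
split=> [epi_f Z g gf0|epi_f Z g h gfhf].
  by apply: epi_f; rewrite gf0 comp0r.
by apply/subr0_eq/epi_f; rewrite compBl gfhf subrr.
Qed.

Lemma is_epi_comp X Y Z (g : hom A Y Z) (f : hom A X Y) :
  is_epi g -> is_epi f -> is_epi (g \oc f).
Proof.
by move=> epi_g epi_f W u v; rewrite !comp_assoc => /epi_f /epi_g.
Qed.

Lemma is_epi_compr X Y Z (g : hom A Y Z) (f : hom A X Y) :
  is_epi (g \oc f) -> is_epi g.
Proof.
by move=> epi_gf W u v uv; apply: epi_gf; rewrite !comp_assoc uv.
Qed.

Lemma is_epi_idm X : is_epi (idm X).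
Proof. by move=> Z g h; rewrite !comp_idr. Qed.

Lemma kernel_is_mono X Y K (f : hom A X Y) (i : hom A K X) :
  is_kernel f i -> is_mono i.
Proof.
case=> fi0 ker_i W g h ighi.
have [|u [_ uniq_u]] := ker_i W (i \oc g).
  by rewrite comp_assoc fi0 comp0r.
by rewrite -(uniq_u g) // -(uniq_u h).
Qed.

Lemma is_zero_idm X : idm X = 0 -> is_zero X.
Proof.
move=> id0; split=> Y f g.
  by rewrite -(comp_idr f) -(comp_idr g) id0 !compr0.
by rewrite -(comp_idl f) -(comp_idl g) id0 !comp0r.
Qed.

(** One of two complementary idempotents of a local ring is a unit, which
    forces the other one, and the summand it cuts out, to vanish. *)
Lemma local_endo_indecomposable X : local_endo X -> indecomposable X.
Proof.
case=> id_neq0 localX; split=> [[_ zX]|Y Z]; first exact/id_neq0/zX.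
case=> [i1 [i2 [p1 [p2 [p1i1 p2i2 p1i2 p2i1 id_sum]]]]].
have [[g [_ e1g]]|niso1] := EM (is_iso (i1 \oc p1)).
  right; apply: is_zero_idm.
  have p20 : p2 = 0.
    by rewrite -(comp_idr p2) -e1g !comp_assoc p2i1 !comp0r.
  by rewrite -p2i2 p20 comp0r.
have [[g [_ e2g]]|niso2] := EM (is_iso (i2 \oc p2)).
  left; apply: is_zero_idm.
  have p10 : p1 = 0.
    by rewrite -(comp_idr p1) -e2g !comp_assoc p1i2 !comp0r.
  by rewrite -p1i1 p10 comp0r.
have [] := localX _ _ niso1 niso2; rewrite id_sum.
by exists (idm X); rewrite comp_idl.
Qed.

(** The map [f p1 - g p2] on the biproduct of [Y] and [P] is epi because [f] is,
    hence it is the cokernel of its own kernel [K].  A map that kills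
    [K -> P] therefore extends along it, and the extension vanishes on [Y]. *)
Lemma pullback_epi : abelian_cat A ->
  forall X Y P (f : hom A Y X) (g : hom A P X), is_epi f ->
  exists K (a : hom A K Y) (b : hom A K P), f \oc a = g \oc b /\ is_epi b.
Proof.
case=> -[_ biprod] has_ker _ _ epi_normal X Y P f g epi_f.
have [S [i1 [i2 [p1 [p2 [p1i1 p2i2 p1i2 p2i1 _]]]]]] := biprod Y P.
pose d := f \oc p1 - g \oc p2.
have di1 : d \oc i1 = f.
  by rewrite compBl -!comp_assoc p1i1 p2i1 comp_idr compr0 subr0.
have epi_d : is_epi d by apply: (is_epi_compr (f := i1)); rewrite di1.
have [K [i [di0 ker_i]]] := has_ker _ _ d.
exists K, (p1 \oc i), (p2 \oc i); split.
  by apply/subr0_eq; rewrite !comp_assoc -compBl.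
apply/is_epi0P => W u; rewrite comp_assoc => up2i0.
have [V [w [dw0 coker_d]]] := epi_normal _ _ d epi_d.
have [t [it_w _]] := ker_i _ w dw0.
have [|v [vd _]] := coker_d _ (u \oc p2).
  by rewrite -it_w comp_assoc up2i0 comp0r.
have v0 : v = 0.
  apply: (proj1 (is_epi0P f) epi_f).
  by rewrite -di1 comp_assoc vd -comp_assoc p2i1 compr0.
by rewrite -(comp_idr u) -p2i2 comp_assoc -vd v0 !comp0r.
Qed.

(** A map from [P] to the target of an epi lifts after pulling the epi back to
    [P], where it splits. *)
Lemma split_epis_projective P : abelian_cat A ->
  (forall Y (e : hom A Y P), is_epi e -> exists s, e \oc s = idm P) ->
  is_projective P.
Proof.
move=> abelA splitP Y Z e epi_e f.
have [K [a [b [ea_fb epi_b]]]] := pullback_epi abelA f epi_e.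
have [s bs] := splitP _ _ epi_b.
by exists (a \oc s); rewrite comp_assoc ea_fb -comp_assoc bs comp_idr.
Qed.

Definition factors X Y Z (f : hom A X Z) (g : hom A Y Z) : Prop :=
  exists h : hom A X Y, g \oc h = f.

(** A map out of a direct sum of local objects is assembled from its
    restrictions to the summands, each of which is isomorphic to some [T i]. *)
Lemma factors_by_tests n (T : 'I_n -> obj A) (ksA : krull_schmidt A)
    (Tall : forall Y, indecomposable Y -> exists i, isomorphic Y (T i))
    X Y Z (f : hom A X Z) (g : hom A Y Z) :
  (forall i (q : hom A (T i) X), factors (f \oc q) g) -> factors f g.
Proof.
move=> test; have [m [L [locL [inj [prj [_ _ id_sum]]]]]] := ksA.2 X.
have facL j : exists h, g \oc h = f \oc inj j.
  have [i [u [v [vu _]]]] := Tall _ (local_endo_indecomposable (locL j)).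
  have [h gh] := test i (inj j \oc v).
  by exists (h \oc u); rewrite comp_assoc gh -!comp_assoc vu comp_idr.
have [h gh] := fin_all_exists facL.
exists (\sum_j h j \oc prj j).
rewrite -[RHS]comp_idr -id_sum !raddf_sum.
by apply: eq_bigr => j _ /=; rewrite comp_assoc gh comp_assoc.
Qed.

End Preadditive.

(** * Dimension counts in hom-spaces *)

Section HomFinite.

Context {k : fieldType} {A : kcategory k} (homfinA : hom_finite A).
Implicit Types X Y Z W P : obj A.

Definition homv_axiom X Y :
    Vector.axiom (projT1 (cid (homfinA X Y))) (hom A X Y) :=
  inhabited_witness (projT2 (cid (homfinA X Y))).

(** The operations of [homv X Y] are those of [hom A X Y], but the two module
    structures are not convertible as records; this is why the linearity of
    composition is established anew in [postcompvE] and [precompvE]. *)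
Definition homv X Y : vectType k :=
  HB.pack (GRing.Lmodule.sort (hom A X Y))
    (Lmodule_hasFinDim.Build k (hom A X Y) (homv_axiom X Y)).

Definition postcompv W X Y (f : hom A X Y) : 'Hom(homv W X, homv W Y) :=
  linfun (comp f : homv W X -> homv W Y).

Definition precompv Z X Y (f : hom A X Y) : 'Hom(homv Y Z, homv X Z) :=
  linfun (precomp f : homv Y Z -> homv X Z).

Lemma postcompvE W X Y (f : hom A X Y) (g : hom A W X) :
  postcompv W f g = f \oc g.
Proof.
have lin_f : linear (comp f : homv W X -> homv W Y) by exact: comp_linear_r.
pose F : {linear homv W X -> homv W Y} := HB.pack
  (comp f : homv W X -> homv W Y) (GRing.isLinear.Build k _ _ _ _ lin_f).
exact: (lfunE F).
Qed.

Lemma precompvE Z X Y (f : hom A X Y) (g : hom A Y Z) :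
  precompv Z f g = g \oc f.
Proof.
have lin_f : linear (precomp f : homv Y Z -> homv X Z) by exact: comp_linear_l.
pose F : {linear homv Y Z -> homv X Z} := HB.pack
  (precomp f : homv Y Z -> homv X Z) (GRing.isLinear.Build k _ _ _ _ lin_f).
exact: (lfunE F).
Qed.

Lemma memv_postcompvP W X Y (f : hom A X Y) (g : homv W Y) :
  reflect (factors g f) (g \in limg (postcompv W f)).
Proof.
apply: (iffP memv_imgP) => [[h _ ->]|[h <-]].
  by exists h; rewrite postcompvE.
by exists h; rewrite ?memvf ?postcompvE.
Qed.

(** Precomposition with an epi [f] is an injective endomorphism of [hom X X],
    hence bijective, and a preimage of the identity is a left inverse of [f];
    an epi with a left inverse is invertible. *)
Lemma epi_endo_split X (f : hom A X X) : is_epi f -> exists g, f \oc g = idm X.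
Proof.
move=> epi_f.
have inj_f : lker (precompv X f) == 0%VS.
  by apply/lker0P => u v; rewrite !precompvE; apply: epi_f.
have : (idm X : homv X X) \in limg (precompv X f).
  by rewrite lker0_limgf ?memvf.
case/memv_imgP => g _; rewrite precompvE => gf.
by exists g; apply: epi_f; rewrite -comp_assoc -gf comp_idr comp_idl.
Qed.

Context {n : nat} (T : 'I_n -> obj A).

(** The size of the sieve generated by [f], measured on the objects [T i].  At
    an identity it is the total dimension of the spaces [hom (T i) X], which
    serves as the size of the object [X]. *)
Definition imsize X Y (f : hom A X Y) : nat :=
  \sum_i \dim (limg (postcompv (T i) f)).

(** Postcomposition with a mono is injective, so no dimension is lost: a mono
    whose source is as large as its target will therefore split. *)
Lemma imsize_mono X Y (m : hom A X Y) : is_mono m -> imsize m = imsize (idm X).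
Proof.
have dim_mono W U V (g : hom A U V) :
    is_mono g -> \dim (limg (postcompv W g)) = \dim {:homv W U}.
  move=> mono_g; rewrite limg_dim_eq // capfv; apply/eqP/lker0P => u v.
  by rewrite !postcompvE; apply: mono_g.
move=> mono_m; apply: eq_bigr => i _; rewrite !dim_mono //.
by move=> W u v; rewrite !comp_idl.
Qed.

Context (Tall : forall Y, indecomposable Y -> exists i, isomorphic Y (T i)).
Context (ksA : krull_schmidt A).

(** The images of [hom (T i) X] are contained in those of [hom (T i) Y] because
    [f] factors through [g]; equal total dimension makes each inclusion an
    equality, and the [T i] suffice to test factorizations. *)
Lemma factors_imsize X Y Z (f : hom A X Z) (g : hom A Y Z) :
  factors f g -> (imsize g <= imsize f)%N -> factors g f.
Proof.
case=> h gh_f le_gf.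
have sub i : (limg (postcompv (T i) f) <= limg (postcompv (T i) g))%VS.
  apply/subvP => q /memv_postcompvP[u <-]; apply/memv_postcompvP.
  by exists (h \oc u); rewrite comp_assoc gh_f.
have eq_im i : limg (postcompv (T i) f) = limg (postcompv (T i) g).
  apply/eqP; rewrite eqEsubv sub /=.
  have /geq_leqif := leqif_sum (fun j (_ : true) => dimv_leqif_sup (sub j)).
  by rewrite -!/(imsize _) le_gf => /esym/forallP/(_ i).
apply: (factors_by_tests ksA Tall) => i q.
apply/memv_postcompvP; rewrite eq_im; apply/memv_postcompvP.
by exists q.
Qed.

(** * Least epimorphisms onto an object *)

Context (abelA : abelian_cat A).

(** A smallest element for the factorization preorder, unique only up to
    factorization in both directions: sources of least epis can differ. *)
Definition least_epi P X (p : hom A P X) : Prop :=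
  is_epi p /\ forall Y (f : hom A Y X), is_epi f -> factors p f.

(** Minimal size already gives least: pulling [p] back along another epi [f]
    yields an epi onto [X] below both, which by minimality is no smaller
    than [p]. *)
Lemma least_epi_exists X : exists P (p : hom A P X), least_epi p.
Proof.
pose Q m := exists P (p : hom A P X), is_epi p /\ imsize p = m.
have exQ : exists m, `[< Q m >].
  exists (imsize (idm X)); apply/asboolP; exists X, (idm X).
  by split=> //; apply: is_epi_idm.
case: (ex_minnP exQ) => m /asboolP[P [p [epi_p size_p]]] min_m.
exists P, p; split=> // Y f epi_f.
have [K [a [b [fa_pb epi_b]]]] := pullback_epi abelA p epi_f.
have [s pbs] : factors p (p \oc b).
  apply: factors_imsize; first by exists b.
  rewrite size_p; apply/min_m/asboolP; exists K, (p \oc b).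
  by split=> //; apply: is_epi_comp.
by exists (a \oc s); rewrite comp_assoc fa_pb.
Qed.

(** If [g f = 0], then [f] factors through the kernel [I] of [g], and [p f = p]
    makes the restriction of [p] to [I] a least epi.  By minimality [I] is all
    of [P], so [g = 0]; thus [f] is epi.  The conclusion only gives a right
    inverse of [f] because that is what splits an epi [e] when [f = e s]. *)
Lemma minimal_least_epi_endo P X (p : hom A P X) (f : hom A P P) :
  least_epi p ->
  (forall I (q : hom A I X), least_epi q ->
     (imsize (idm P) <= imsize (idm I))%N) ->
  p \oc f = p -> exists g, f \oc g = idm P.
Proof.
move=> [epi_p least_p] minP pf; apply/epi_endo_split/is_epi0P => Z g gf0.
have [_ has_ker _ _ _] := abelA.
have [I [i ker_i]] := has_ker _ _ g.
have [h [ih _]] := ker_i.2 _ f gf0.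
have least_pi : least_epi (p \oc i).
  split=> [|Y e /least_p[u eu]].
    by apply: (is_epi_compr (f := h)); rewrite -comp_assoc ih pf.
  by exists (u \oc i); rewrite comp_assoc eu.
have [s is_id] : factors (idm P) i.
  apply: factors_imsize; first by exists i; rewrite comp_idl.
  by rewrite (imsize_mono (kernel_is_mono ker_i)); apply: minP least_pi.
by rewrite -(comp_idr g) -is_id comp_assoc ker_i.1 comp0r.
Qed.

Lemma projective_least_epi_exists X :
  exists P (p : hom A P X), is_projective P /\ is_epi p.
Proof.
pose Q m := exists P (p : hom A P X), least_epi p /\ imsize (idm P) = m.
have exQ : exists m, `[< Q m >].
  have [P [p least_p]] := least_epi_exists X.
  by exists (imsize (idm P)); apply/asboolP; exists P, p.
case: (ex_minnP exQ) => m /asboolP[P [p [least_p size_P]]] min_m.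
have [epi_p below_p] := least_p.
exists P, p; split=> //; apply: split_epis_projective => // Y e epi_e.
have [s pes] := below_p _ _ (is_epi_comp epi_p epi_e).
have [||g esg] := minimal_least_epi_endo (f := e \oc s) least_p.
- by move=> I q least_q; rewrite size_P; apply/min_m/asboolP; exists I, q.
- by rewrite comp_assoc.
by exists (s \oc g); rewrite comp_assoc.
Qed.

End HomFinite.

Theorem theorem9 (k : fieldType) (A : kcategory k)
  (abelA : abelian_cat A)
  (homfinA : hom_finite A)
  (ksA : krull_schmidt A)
  (fintypeA : finitely_many_indecomposables A) :
  enough_projectives A.
Proof.
have [n [T Tall]] := fintypeA.
exact: (projective_least_epi_exists homfinA Tall ksA abelA).
Qed.
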